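(* Let $A\to B$ be a morphism of Artin local rings with $\operatorname{edim}(A)=\operatorname{edim}(B)$. Then every $B$-module $M$ that is flat as an $A$-module is flat as a $B$-module.
   Context: All rings are commutative with unit. For a local ring $A$ with maximal ideal $\mathfrak{m}_A$, the embedding dimension $\operatorname{edim}(A)$ is the minimal number of generators of $\mathfrak{m}_A$. The module $M$ is not assumed to be finitely generated. *)

(* Defs.v *)
From HB Require Import structures.
From mathcomp Require Import all_boot all_algebra.
From mathcomp Require Import generic_quotient ring_quotient.
From mathcomp Require Import boolp classical_sets.
From mathcomp.multinomials Require Import freeg.

Set Implicit Arguments.
Unset Strict Implicit.
Unset Printing Implicit Defensive.

Import GRing.Theory.
Local Open Scope classical_set_scope.
Local Open Scope ring_scope.
Local Open Scope quotient_scope.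

Section Ideals.
Variable R : comNzRingType.
Implicit Types I J : set R.

Definition ideal I : Prop := GRing.submod_closed (mem I : {pred R^o}).

Definition maximal_ideal I : Prop :=
  [/\ ideal I, I != setT
    & forall J, ideal J -> I `<=` J -> J = I \/ J = setT].

Definition generated_by I (n : nat) : Prop :=
  exists g : 'I_n -> R, I = smallest ideal (range g).

(* The value is 0 when I is not finitely generated; this never occurs for the
   maximal ideal of an Artinian ring, which is Noetherian. *)
Definition min_generators I : nat :=
  xget 0%N [set n | generated_by I n /\
                    forall k, generated_by I k -> (n <= k)%N].

End Ideals.

Section LocalArtin.
Variable R : comNzRingType.

Definition local_ring : Prop := exists! m : set R, maximal_ideal m.

Definition artinian : Prop :=
  forall I : nat -> set R,
    (forall n, ideal (I n)) -> (forall n, I n.+1 `<=` I n) ->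
  exists n, forall k, (n <= k)%N -> I k = I n.

(* Only meaningful for local rings. *)
Definition local_maximal_ideal : set R := get (@maximal_ideal R).

Definition edim : nat := min_generators local_maximal_ideal.

End LocalArtin.

Arguments local_ring : clear implicits.
Arguments artinian : clear implicits.
Arguments local_maximal_ideal : clear implicits.
Arguments edim : clear implicits.

(* The tensor product of M and N over R: the free abelian group on M * N modulo
   the subgroup generated by the bilinearity relations. *)
Section Tensor.
Variables (R : comNzRingType) (M N : lmodType R).

Inductive tensor_rel : {freeg (M * N)%type / int} -> Prop :=
| tensor_rel_addl m m' n :
    tensor_rel (<< (m + m', n) >> - << (m, n) >> - << (m', n) >>)
| tensor_rel_addr m n n' :
    tensor_rel (<< (m, n + n') >> - << (m, n) >> - << (m, n') >>)
| tensor_rel_scale (a : R) m n :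
    tensor_rel (<< (a *: m, n) >> - << (m, a *: n) >>)
| tensor_rel0 : tensor_rel 0
| tensor_relB x y : tensor_rel x -> tensor_rel y -> tensor_rel (x - y).

Definition tensor_relb : {pred {freeg (M * N)%type / int}} :=
  fun x => `[< tensor_rel x >].

Fact tensor_rel_zmod_closed : zmod_closed tensor_relb.
Proof.
split=> [|x y /asboolP rx /asboolP ry]; apply/asboolP.
  exact: tensor_rel0.
exact: tensor_relB.
Qed.

HB.instance Definition _ :=
  GRing.isZmodClosed.Build _ tensor_relb tensor_rel_zmod_closed.

Definition tensor : zmodType := {ideal_quot tensor_relb}.

Definition pure_tensor (m : M) (n : N) : tensor :=
  \pi_{ideal_quot tensor_relb} << (m, n) >>.

Lemma eq_tensorP (x y : {freeg (M * N)%type / int}) :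
  \pi_{ideal_quot tensor_relb} x = \pi_{ideal_quot tensor_relb} y <-> tensor_rel (x - y).
Proof.
split=> [/eqP|h].
  by rewrite -(@Quotient.idealrBE _ tensor_relb) => /asboolP.
by apply/eqP; rewrite -(@Quotient.idealrBE _ tensor_relb); apply/asboolP.
Qed.

End Tensor.

Section TensorMap.
Variables (R : comNzRingType) (M N N' : lmodType R) (f : {linear N -> N'}).

Definition freeg_map : {freeg (M * N)%type / int} -> {freeg (M * N')%type / int} :=
  fglift (fun p : M * N => << (p.1, f p.2) >> : {freeg (M * N')%type / int}).

HB.instance Definition _ := GRing.isZmodMorphism.Build
  {freeg (M * N)%type / int} {freeg (M * N')%type / int} freeg_map
  (lift_is_additive _).

(* id_M (x) f, computed on a representative; independence of the representative
   is tensor_map_pi. *)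
Definition tensor_map (t : tensor M N) : tensor M N' :=
  \pi_{ideal_quot @tensor_relb R M N'} (freeg_map (repr t)).

Lemma freeg_map_rel x : tensor_rel x -> tensor_rel (freeg_map x).
Proof.
elim=> [m m' n|m n n'|a m n||y z _ hy _ hz].
- rewrite !raddfB /= /freeg_map !liftU !scale1r /=; exact: tensor_rel_addl.
- rewrite !raddfB /= /freeg_map !liftU !scale1r /= raddfD.
  exact: tensor_rel_addr.
- rewrite !raddfB /= /freeg_map !liftU !scale1r /= linearZ.
  exact: tensor_rel_scale.
- rewrite raddf0; exact: tensor_rel0.
- rewrite raddfB; exact: tensor_relB.
Qed.

Lemma tensor_map_pi x :
  tensor_map (\pi_{ideal_quot @tensor_relb R M N} x) =
  \pi_{ideal_quot @tensor_relb R M N'} (freeg_map x).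
Proof.
apply/eq_tensorP; rewrite -raddfB; apply: freeg_map_rel.
by apply/eq_tensorP; rewrite reprK.
Qed.

Lemma tensor_map_pure m n : tensor_map (pure_tensor m n) = pure_tensor m (f n).
Proof. by rewrite tensor_map_pi /freeg_map liftU scale1r. Qed.

End TensorMap.

Arguments tensor_map {R} M {N N'} f t.

Definition flat (R : comNzRingType) (M : lmodType R) : Prop :=
  forall (N N' : lmodType R) (f : {linear N -> N'}),
    injective f -> injective (tensor_map M f).

(* M seen as an A-module through phi. *)
Definition restrict_scalars (A B : comNzRingType) (phi : {rmorphism A -> B})
  (M : lmodType B) : Type := M.

Section RestrictScalars.
Variables (A B : comNzRingType) (phi : {rmorphism A -> B}) (M : lmodType B).
Local Notation M_A := (restrict_scalars phi M).

HB.instance Definition _ := GRing.Zmodule.on M_A.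

Definition restrict_scale (a : A) (x : M_A) : M_A := phi a *: (x : M).

Fact restrict_scaleA a b x :
  restrict_scale a (restrict_scale b x) = restrict_scale (a * b) x.
Proof. by rewrite /restrict_scale scalerA rmorphM. Qed.

Fact restrict_scale1 : left_id 1 restrict_scale.
Proof. by move=> x; rewrite /restrict_scale rmorph1 scale1r. Qed.

Fact restrict_scaleDr : right_distributive restrict_scale +%R.
Proof. by move=> a x y; rewrite /restrict_scale scalerDr. Qed.

Fact restrict_scaleDl x : {morph restrict_scale^~ x : a b / a + b}.
Proof. by move=> a b; rewrite /restrict_scale rmorphD scalerDl. Qed.

HB.instance Definition _ := GRing.Zmodule_isLmodule.Build A M_A
  restrict_scaleA restrict_scale1 restrict_scaleDr restrict_scaleDl.

End RestrictScalars.

(* Main.v *)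
(* Let x_1, ..., x_n be minimal generators of m_A, let b_1, ..., b_m generate
   m_B (here m = n, but m <= n suffices), and write phi x_j = c_j . b with c_j
   in B^m. Since M is A-flat, sum_j x_j p_j = 0 forces every p_j into m_A M, and
   the same holds in each term of the Koszul complex K(b; M).

   Let z be a 1-cycle of K(b; M). By descending induction on |I|, the element
   c_I /\ z lies in m_A K + dK: for |I| = n it has degree n + 1 > m, so it is
   0; if c_r /\ c_I /\ z = sum_j x_j p_j + dq with r not in I, then applying d
   gives a relation sum_j x_j t_j = 0 with t_r = c_I /\ z - d p_r, so c_I /\ z
   lies in m_A K + dK as well. For empty I, z = sum_j x_j p_j + dq. Moreover
   x_j p_j is homologous to c_j (b . p_j), and (b . p_j)_j is a relation
   between the x_j in M, which by flatness comes from syzygies over A. Hence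
   every 1-cycle of K(b; M) comes from H_1(b; B) (x) M, that is
   Tor_1^B(k, M) = 0, and M is free because Nakayama's lemma holds over B for
   arbitrary modules. *)
Require Import Defs.
From HB Require Import structures.
From mathcomp Require Import all_boot all_algebra.
From mathcomp Require Import generic_quotient ring_quotient.
From mathcomp Require Import boolp classical_sets.
From mathcomp.multinomials Require Import freeg.

Set Implicit Arguments.
Unset Strict Implicit.
Unset Printing Implicit Defensive.

Import GRing.Theory.
Local Open Scope classical_set_scope.
Local Open Scope ring_scope.
Local Open Scope quotient_scope.

(** * The Koszul complex with coefficients in a module *)

Section Koszul.
Variables (R : comNzRingType) (M : lmodType R).
Implicit Types (b c : nat -> R) (n : nat).

(* M (x) Lambda(R^n), the pair (x, y) standing for x + e_n y. *)
Fixpoint koszul n : lmodType R :=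
  if n is k.+1 then (koszul k * koszul k)%type : lmodType R else M.

(** Left exterior multiplication by $\sum_i c_i e_i$; the sign comes from moving it past $e_k$. *)
Fixpoint wedge c n : koszul n -> koszul n :=
  if n is k.+1 return koszul n -> koszul n then
    fun x => (wedge c x.1, c k *: x.1 - wedge c x.2)
  else fun=> 0.

(** The Koszul differential: contraction by the linear form $e_i \mapsto b_i$, with the same sign
    rule. *)
Fixpoint contr b n : koszul n -> koszul n :=
  if n is k.+1 return koszul n -> koszul n then
    fun x => (contr b x.1 + b k *: x.2, - contr b x.2)
  else fun=> 0.

Fact wedge_is_linear c n : linear (@wedge c n).
Proof.
elim: n => [|n IHn] a x y /=; first by rewrite scaler0 addr0.
rewrite !IHn; congr (_, _) => /=.
by rewrite scalerDr scalerBr !scalerA mulrC opprD addrACA.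
Qed.

HB.instance Definition _ c n :=
  GRing.isLinear.Build R (koszul n) (koszul n) _ _ (@wedge_is_linear c n).

Fact contr_is_linear b n : linear (@contr b n).
Proof.
elim: n => [|n IHn] a x y /=; first by rewrite scaler0 addr0.
rewrite !IHn; congr (_, _) => /=; last by rewrite scalerN opprD.
by rewrite !scalerDr !scalerA mulrC addrACA.
Qed.

HB.instance Definition _ b n :=
  GRing.isLinear.Build R (koszul n) (koszul n) _ _ (@contr_is_linear b n).

Lemma contrK b n (x : koszul n) : contr b (contr b x) = 0.
Proof.
elim: n x => [|n IHn] x //=.
by rewrite linearD linearZ !linearN /= !IHn add0r subrr opprK.
Qed.

(** The antiderivation rule. It makes [wedge c] a homotopy between 0 and multiplication by $\sum_i
    c_i b_i$. *)
Lemma contr_wedge b c n (x : koszul n) :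
  contr b (wedge c x) =
  (\sum_(i < n) c i * b i) *: x - wedge c (contr b x).
Proof.
elim: n x => [|n IHn] x /=; first by rewrite big_ord0 scale0r subrr.
rewrite big_ord_recr /= !linearB !linearD !linearZ !linearN /= !IHn.
case: x => x1 x2 /=; congr (_, _) => /=.
  by rewrite scalerN scalerDl scalerA opprD addrACA.
rewrite scalerN !opprD !opprK scalerDl scalerA [b n * _]mulrC addrCA.
by rewrite -!addrA; congr (_ + _); rewrite [RHS]addrCA addNKr.
Qed.

(** All components of exterior degree below [k] vanish. The truncated [k.-1] is harmless at [k = 0],
    where the condition is empty. *)
Fixpoint deg_ge n k : koszul n -> Prop :=
  if n is n'.+1 return koszul n -> Prop then
    fun x => deg_ge k x.1 /\ deg_ge k.-1 x.2
  else fun x => k = 0%N \/ x = 0.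

Lemma deg_ge_sub n k (x y : koszul n) :
  deg_ge k x -> deg_ge k y -> deg_ge k (x - y).
Proof.
elim: n k x y => [|n IHn] k x y /=.
  case=> [->|->]; first by left.
  by case=> [->|->]; [left|right; rewrite subr0].
by case=> hx1 hx2 [hy1 hy2]; split; apply: IHn.
Qed.

Lemma deg_ge_scale n k a (x : koszul n) : deg_ge k x -> deg_ge k (a *: x).
Proof.
elim: n k x => [|n IHn] k x /=.
  by case=> [->|->]; [left|right; rewrite scaler0].
by case=> hx1 hx2; split; apply: IHn.
Qed.

Lemma deg_ge0 n (x : koszul n) : deg_ge 0 x.
Proof. by elim: n x => [|n IHn] x /=; [left|split; apply: IHn]. Qed.

Lemma deg_ge_wedge c n k (x : koszul n) :
  deg_ge k x -> deg_ge k.+1 (wedge c x).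
Proof.
elim: n k x => [|n IHn] k x /=; first by right.
case=> hx1 hx2; split; first exact: IHn.
apply: deg_ge_sub; first exact: deg_ge_scale.
by case: k hx1 hx2 => [|k] _ hx2; [exact: deg_ge0|exact: IHn].
Qed.

Lemma deg_ge_gt n k (x : koszul n) : (n < k)%N -> deg_ge k x -> x = 0.
Proof.
elim: n k x => [|n IHn] k x /=; first by case: k => // k _ [].
case: k => // k lt_nk [hx1 hx2]; case: x hx1 hx2 => x1 x2 /= hx1 hx2.
by rewrite (IHn _ _ (ltnW lt_nk) hx1) (IHn _ _ lt_nk hx2).
Qed.

Fixpoint inj0 n (m : M) : koszul n :=
  if n is k.+1 return koszul n then (inj0 k m, 0) else m.

(** The 1-chain $\sum_{i<n} e_i z_i$. *)
Fixpoint inj1 n (z : nat -> M) : koszul n :=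
  if n is k.+1 return koszul n then (inj1 k z, inj0 k (z k)) else 0.

Fixpoint coord0 n : koszul n -> M :=
  if n is k.+1 return koszul n -> M then fun x => coord0 x.1 else id.

Fixpoint coord1 i n : koszul n -> M :=
  if n is k.+1 return koszul n -> M then
    fun x => if i == k then coord0 x.2 else coord1 i x.1
  else fun=> 0.

Fact coord0_is_linear n : linear (@coord0 n).
Proof. by elim: n => //= n IHn a x y; rewrite IHn. Qed.

HB.instance Definition _ n :=
  GRing.isLinear.Build R (koszul n) M _ _ (@coord0_is_linear n).

Fact coord1_is_linear i n : linear (@coord1 i n).
Proof.
elim: n => [|n IHn] a x y /=; first by rewrite scaler0 addr0.
by case: ifP => _; rewrite ?linearP ?IHn.
Qed.

HB.instance Definition _ i n :=
  GRing.isLinear.Build R (koszul n) M _ _ (@coord1_is_linear i n).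

Lemma coord0K n : cancel (@inj0 n) (@coord0 n).
Proof. by elim: n. Qed.

Lemma coord1K n z i : (i < n)%N -> coord1 i (inj1 n z) = z i.
Proof.
elim: n => // n IHn; rewrite ltnS leq_eqVlt /=.
by case: eqP => [->|_ /IHn]; rewrite ?coord0K.
Qed.

Lemma contr_inj0 b n m : contr b (inj0 n m) = 0.
Proof. by elim: n => //= n ->; rewrite scaler0 addr0 linear0 oppr0. Qed.

Lemma inj0_is_linear n : linear (@inj0 n).
Proof.
elim: n => //= n IHn a x y; rewrite IHn.
by congr (_, _); rewrite /= scaler0 addr0.
Qed.

HB.instance Definition _ n :=
  GRing.isLinear.Build R M (koszul n) _ _ (@inj0_is_linear n).

Lemma contr_inj1 b n z :
  contr b (inj1 n z) = inj0 n (\sum_(i < n) b i *: z i).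
Proof.
elim: n => [|n IHn] /=; first by rewrite big_ord0.
by rewrite big_ord_recr IHn contr_inj0 oppr0 linearD linearZ.
Qed.

Lemma deg_ge_inj1 n z : deg_ge 1 (inj1 n z).
Proof. by elim: n => [|n IHn] /=; [right|split=> //; exact: deg_ge0]. Qed.

Lemma coord0_contr b n (x : koszul n) :
  coord0 (contr b x) = \sum_(i < n) b i *: coord1 i x.
Proof.
elim: n x => [|n IHn] x /=; first by rewrite big_ord0.
rewrite big_ord_recr eqxx linearD linearZ /= IHn; congr (_ + _).
by apply: eq_bigr => i _; rewrite ltn_eqF.
Qed.

(* The submodule generated by the vectors s m, for m in M and s a syzygy
   of b_0, ..., b_(n-1); only the first n entries of a vector matter. *)
Inductive syz n b : (nat -> M) -> Prop :=
| syz_nil z : (forall i, (i < n)%N -> z i = 0) -> syz n b z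
| syz_cons (s : nat -> R) m z z' : \sum_(i < n) b i * s i = 0 -> syz n b z ->
    (forall i, (i < n)%N -> z' i = s i *: m + z i) -> syz n b z'.

Lemma syz_ext n b z z' :
  (forall i, (i < n)%N -> z' i = z i) -> syz n b z -> syz n b z'.
Proof.
move=> ezz' hz; case: hz ezz' => [{}z h|s m {}z z1 hs hz h] ezz'.
  by apply: syz_nil => i lin; rewrite ezz' ?h.
by apply: (syz_cons hs hz) => i lin; rewrite ezz' ?h.
Qed.

Lemma syz_add n b z z' : syz n b z -> syz n b z' -> syz n b (z \+ z').
Proof.
elim=> [{}z h|s m {}z z1 hs _ IH h] hz'.
  by apply: syz_ext hz' => i lin /=; rewrite h ?add0r.
by apply: (syz_cons hs (IH hz')) => i lin /=; rewrite h // addrA.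
Qed.

Lemma syz_gen n b (s : nat -> R) m :
  \sum_(i < n) b i * s i = 0 -> syz n b (fun i => s i *: m).
Proof.
move=> hs; apply: (syz_cons (z := fun=> 0) (m := m) hs); first exact: syz_nil.
by move=> i _; rewrite addr0.
Qed.

Lemma syz_opp n b z : syz n b z -> syz n b (\- z).
Proof.
elim=> [{}z h|s m {}z z' hs _ IH h].
  by apply: syz_nil => i lin /=; rewrite h ?oppr0.
apply: (syz_cons (s := s) (m := - m) hs IH) => i lin /=.
by rewrite h // opprD scalerN.
Qed.

Lemma syz_sum n b (I : Type) (r : seq I) (F : I -> nat -> M) :
  (forall k, syz n b (F k)) -> syz n b (fun i => \sum_(k <- r) F k i).
Proof.
move=> hF; elim: r => [|k r IHr].
  by apply: syz_nil => i _; rewrite big_nil.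
apply: syz_ext (syz_add (hF k) IHr) => i _; exact: big_cons.
Qed.

Lemma syz_widen n b z :
  syz n b z -> syz n.+1 b (fun i => if i == n then 0 else z i).
Proof.
elim=> [{}z h|s m {}z z' hs _ IH h].
  apply: syz_nil => i; rewrite ltnS leq_eqVlt.
  by case: eqP => //= _; exact: h.
apply: (syz_cons (s := fun i => if i == n then 0 else s i) (m := m) _ IH).
  rewrite big_ord_recr /= eqxx mulr0 addr0 -[RHS]hs.
  by apply: eq_bigr => i _; rewrite ltn_eqF.
move=> i; rewrite ltnS leq_eqVlt; case: eqP => [->|_ /= /h //].
by rewrite scale0r addr0.
Qed.

(** The degree 1 part of a boundary is a combination of Koszul syzygies $b_j e_k - b_k e_j$; the
    induction on [n] adds those that involve the last basis vector. *)
Lemma syz_boundary b n (x : koszul n) : syz n b (fun i => coord1 i (contr b x)).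
Proof.
elim: n x => [|n IHn] x; first exact: syz_nil.
(* The syzygy $b_n e_k - b_k e_n$, to be multiplied by the coefficient of $e_k$ in [x.2]. *)
pose s k i := if i == n then - b k else (i == k)%:R * b n.
have hs (k : 'I_n) : \sum_(i < n.+1) b i * s k i = 0.
  rewrite big_ord_recr /= /s eqxx mulrN (bigD1 k) //= big1 ?addr0.
    by rewrite ltn_eqF // eqxx mul1r mulrC subrr.
  move=> i neq_ik; rewrite ltn_eqF // (_ : (i == k :> nat) = false) ?mul0r
    ?mulr0 //.
  exact: negbTE.
have := syz_add (syz_widen (IHn x.1))
  (syz_sum (index_enum _) (fun k : 'I_n => syz_gen (coord1 k x.2) (hs k))).
apply: syz_ext => i; rewrite ltnS leq_eqVlt /= /s.
case: eqP => /= [_ _|_ ltin].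
  rewrite linearN /= coord0_contr add0r -sumrN.
  by apply: eq_bigr => k _; rewrite scaleNr.
rewrite linearD linearZ /=; congr (_ + _).
rewrite (bigD1 (Ordinal ltin)) //= eqxx mul1r big1 ?addr0 // => k.
rewrite -val_eqE /= eq_sym => /negbTE ->; by rewrite mul0r scale0r.
Qed.

End Koszul.

(** * Descent through exterior products of the coefficient vectors *)

Section Descent.
Variables (R : comNzRingType) (n : nat) (y : nat -> R).

(** When the [y j] generate the maximal ideal of a local ring and [L] is that ring, this is
    minimality of the generators. *)
Definition min_syz (L : lmodType R) := forall p : nat -> L,
  \sum_(j < n) y j *: p j = 0 ->
  forall j, (j < n)%N -> exists q : nat -> L, p j = \sum_(k < n) y k *: q k.

Lemma min_syz_prod (L L' : lmodType R) :
  min_syz L -> min_syz L' -> min_syz (L * L')%type.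
Proof.
move=> hL hL' p hp j ltjn.
have [|q hq] := hL (fun j => (p j).1) _ j ltjn.
  by have /(congr1 fst) := hp; rewrite raddf_sum.
have [|q' hq'] := hL' (fun j => (p j).2) _ j ltjn.
  by have /(congr1 snd) := hp; rewrite raddf_sum.
exists (fun k => (q k, q' k)); rewrite [LHS]surjective_pairing hq hq'.
by rewrite [RHS]surjective_pairing !raddf_sum.
Qed.

Variables (M : lmodType R) (m : nat) (b : nat -> R) (c : nat -> nat -> R).
Hypothesis min_M : min_syz M.
Hypothesis ycb : forall j, y j = \sum_(i < m) c j i * b i.

Let K := koszul M m.

Lemma min_syz_koszul k : min_syz (koszul M k).
Proof. by elim: k => //= k IHk; exact: min_syz_prod. Qed.

Let wedges (s : seq nat) (x : K) : K := foldr (fun j w => wedge (c j) w) x s.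

(** The submodule $(y)K + dK$ in which the descent takes place. *)
Let IK (w : K) : Prop :=
  exists (p : nat -> K) q, w = \sum_(j < n) y j *: p j + contr b q.

(** By the antiderivation rule the boundary is $\sum_{i \in I} \pm y_i\, c_{I - i} \wedge x$ with
    $I$ given by [s]. Vanishing of [w] outside [s] serves to isolate one coefficient in
    [descent_step]. *)
Lemma contr_wedges s x : contr b x = 0 -> {subset s <= gtn n} -> uniq s ->
  exists w : nat -> K, (forall j, j \notin s -> w j = 0) /\
    contr b (wedges s x) = \sum_(j < n) y j *: w j.
Proof.
move=> bx0; elim: s => [|a s IHs] /=.
  by exists (fun=> 0); split=> //; rewrite big1 // => i _; rewrite scaler0.
move=> sub /andP[aNs us]; have [|w [w0 hw]] := IHs _ us.
  by move=> j js; apply: sub; rewrite inE js orbT.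
have ltan : (a < n)%N by apply: sub; rewrite inE eqxx.
exists (fun j => if j == a then wedges s x else - wedge (c a) (w j)); split.
  move=> j; rewrite inE negb_or => /andP[/negbTE -> /w0 ->].
  by rewrite linear0 oppr0.
rewrite contr_wedge -ycb hw linear_sum (bigD1 (Ordinal ltan)) //=.
rewrite w0 // scaler0 linear0 add0r [RHS](bigD1 (Ordinal ltan)) //= eqxx.
congr (_ + _); rewrite -sumrN; apply: eq_bigr => i.
by rewrite -val_eqE /= => /negbTE ->; rewrite linearZ scalerN.
Qed.

Lemma descent_step a s x : contr b x = 0 -> {subset a :: s <= gtn n} ->
  uniq (a :: s) -> IK (wedges (a :: s) x) -> IK (wedges s x).
Proof.
move=> bx0 sub us [p [q /(congr1 (@contr _ _ b _))]].
have ltan : (a < n)%N by apply: sub; rewrite inE eqxx.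
have [w [w0 hw]] : exists w : nat -> K, (forall j, j \notin s -> w j = 0) /\
    contr b (wedges s x) = \sum_(j < n) y j *: w j.
  apply: contr_wedges => //; last by case/andP: us.
  by move=> j js; apply: sub; rewrite inE js orbT.
rewrite linearD /= contrK addr0 contr_wedge -ycb hw => h.
(* The two expressions for the boundary of $c_a \wedge c_s \wedge x$, subtracted. As [w a = 0], the
   entry at [a] is $c_s \wedge x - d p_a$, and [min_syz] puts it into $(y)K$. *)
pose r j := (if j == a then wedges s x else 0) - wedge (c a) (w j) - contr b (p
  j).
have /(min_syz_koszul) : \sum_(j < n) y j *: r j = 0.
  under eq_bigr do rewrite /r !scalerBr.
  rewrite !sumrB (bigD1 (Ordinal ltan)) //= eqxx big1 ?addr0; last first.
    by move=> i; rewrite -val_eqE /= => /negbTE ->; rewrite scaler0.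
  apply/eqP; rewrite subr_eq0; apply/eqP.
  have <- : contr b (\sum_(j < n) y j *: p j) = \sum_(i < n) y i *: contr b (p
    i).
    by rewrite linear_sum; apply: eq_bigr => i _; rewrite linearZ.
  rewrite -h; congr (_ - _).
  by rewrite linear_sum; apply: eq_bigr => i _; rewrite linearZ.
case/(_ a ltan) => t; rewrite /r eqxx w0; last by case/andP: us.
rewrite linear0 subr0 => /eqP; rewrite subr_eq => /eqP ->.
by exists t, (p a).
Qed.

Lemma descent x : (m <= n)%N -> deg_ge 1 x -> contr b x = 0 -> IK x.
Proof.
move=> lemn x1 bx0.
(* Here $I = \{k, \dots, n-1\}$, so that induction upwards on [k] shrinks $I$ from the full index
   set to the empty one. *)
suff h k : (k <= n)%N -> IK (wedges (iota k (n - k)) x).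
  by have := h n (leqnn n); rewrite subnn.
have deg s : deg_ge (size s).+1 (wedges s x).
  by elim: s => //= a s; exact: deg_ge_wedge.
elim: k => [_|k IHk ltkn].
  (* A product with all [n] vectors has degree at least $n + 1 > m$. *)
  have -> : wedges (iota 0 (n - 0)) x = 0.
    by apply: deg_ge_gt (deg _); rewrite size_iota subn0 ltnS.
  exists (fun=> 0), 0; rewrite linear0 addr0 big1 // => i _.
  by rewrite scaler0.
have := IHk (ltnW ltkn);
  rewrite subnS -(ltn_predK (_ : 0 < n - k)%N) ?subn_gt0 //.
apply: descent_step => //; last exact: (iota_uniq k (n - k).-1.+1).
move=> j; rewrite (mem_iota k (n - k).-1.+1) => /andP[_].
by rewrite prednK ?subn_gt0 // subnKC // ltnW.
Qed.

(** The degree 1 part of [descent]; the boundary term contributes only syzygies, by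
    [syz_boundary]. *)
Lemma koszul_cycle1 (z : nat -> M) : (m <= n)%N ->
  \sum_(i < m) b i *: z i = 0 ->
  exists (p : nat -> nat -> M) z', syz m b z' /\
    forall i, (i < m)%N -> z i = \sum_(j < n) y j *: p j i + z' i.
Proof.
move=> lemn hz; have [||p [q hpq]] := descent lemn (x := inj1 m z).
- exact: deg_ge_inj1.
- by rewrite contr_inj1 hz linear0.
exists (fun j i => coord1 i (p j)), (fun i => coord1 i (contr b q)); split.
  exact: syz_boundary.
move=> i ltim; rewrite -[LHS](coord1K z ltim) hpq linearD linear_sum.
by congr (_ + _); apply: eq_bigr => j _; rewrite linearZ.
Qed.

End Descent.

(** * The equational criterion for flatness *)

Section Flat.
Variable R : comNzRingType.

Section Span.
Variables (n : nat) (a : nat -> R).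

Definition in_span : {pred R^o} :=
  fun r => `[< exists c : nat -> R, r = \sum_(j < n) a j * c j >].

Fact in_span_submod_closed : submod_closed in_span.
Proof.
split=> [|k r r' /asboolP[c ->] /asboolP[c' ->]]; apply/asboolP.
  by exists (fun=> 0); rewrite big1 // => i _; rewrite mulr0.
exists (fun j => k * c j + c' j); rewrite scaler_sumr -big_split /=.
by apply: eq_bigr => i _; rewrite mulrDr mulrCA.
Qed.

HB.instance Definition _ :=
  GRing.isSubmodClosed.Build R R^o in_span in_span_submod_closed.

(** The ideal of the [a j] as a module in its own right, so that flatness applies to its inclusion
    into [R]. *)
Record span := Span { span_val : R^o; _ : in_span span_val }.
HB.instance Definition _ := [isSub for span_val].
HB.instance Definition _ := [Choice of span by <:].
HB.instance Definition _ := [SubChoice_isSubLmodule of span by <:].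

Lemma span_coef (r : span) :
  exists c : nat -> R, val r = \sum_(j < n) a j * c j.
Proof. by case: r => r /= /asboolP. Qed.

End Span.

(** [fglift] expects a module over the coefficient ring, so the group [V] is seen as a
    $\mathbb{Z}$-module. *)
Definition zlift (K : choiceType) (V : zmodType) (f : K -> V)
  (x : {freeg K / int}) : V := fglift (f : K -> zmodule V) x.

Fact zlift_is_additive (K : choiceType) (V : zmodType) (f : K -> V) :
  zmod_morphism (zlift f).
Proof. exact: (lift_is_additive (f : K -> zmodule V)). Qed.

HB.instance Definition _ (K : choiceType) (V : zmodType) (f : K -> V) :=
  GRing.isZmodMorphism.Build {freeg K / int} V (zlift f) (zlift_is_additive f).

Lemma zliftU (K : choiceType) (V : zmodType) (f : K -> V) k :
  zlift f << k >> = f k.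
Proof. by rewrite /zlift liftU scale1r. Qed.

Section PureTensor.
Variables (M N : lmodType R).
Local Notation pi := (\pi_{ideal_quot @tensor_relb R M N}).

Lemma pi_tensorB x y : pi (x - y) = pi x - pi y :> tensor M N.
Proof. exact: raddfB. Qed.

Lemma pure_tensorDl m m' n :
  pure_tensor (m + m') n = pure_tensor m n + pure_tensor m' n :> tensor M N.
Proof.
apply/eqP; rewrite -subr_eq0 opprD addrA -!pi_tensorB -(raddf0 pi).
by apply/eqP/eq_tensorP; rewrite subr0; exact: tensor_rel_addl.
Qed.

Lemma pure_tensorDr m n n' :
  pure_tensor m (n + n') = pure_tensor m n + pure_tensor m n' :> tensor M N.
Proof.
apply/eqP; rewrite -subr_eq0 opprD addrA -!pi_tensorB -(raddf0 pi).
by apply/eqP/eq_tensorP; rewrite subr0; exact: tensor_rel_addr.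
Qed.

Lemma pure_tensorZ a m n :
  pure_tensor (a *: m) n = pure_tensor m (a *: n) :> tensor M N.
Proof. by apply/eq_tensorP; exact: tensor_rel_scale. Qed.

Lemma pure_tensor0l n : pure_tensor 0 n = 0 :> tensor M N.
Proof.
by apply: (addrI (pure_tensor 0 n)); rewrite -pure_tensorDl !addr0.
Qed.

Lemma pure_tensor0r m : pure_tensor m 0 = 0 :> tensor M N.
Proof.
by apply: (addrI (pure_tensor m 0)); rewrite -pure_tensorDr !addr0.
Qed.

Lemma pure_tensor_suml (I : Type) (r : seq I) (F : I -> M) n :
  pure_tensor (\sum_(i <- r) F i) n =
  \sum_(i <- r) pure_tensor (F i) n :> tensor M N.
Proof.
apply: (big_morph (fun m => pure_tensor m n : tensor M N)).
  by move=> m m'; exact: pure_tensorDl.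
exact: pure_tensor0l.
Qed.

End PureTensor.

Variable M : lmodType R.
Hypothesis flatM : flat M.

(** The element $\sum_j m_j \otimes a_j$ of $M \otimes (a)$ maps to $(\sum_j a_j m_j) \otimes 1 = 0$
    in $M \otimes R$, hence vanishes by flatness. Reading off coefficients with respect to the [a j]
    turns tensor relations into syzygies. *)
Lemma flat_syz n (a : nat -> R) (m : nat -> M) :
  \sum_(j < n) a j *: m j = 0 -> syz n a m.
Proof.
move=> am0.
pose delta (j i : nat) : R := (j == i)%:R.
have e_sub j : exists e : span n a, (j < n)%N -> val e = a j.
  have [ltjn|_] := ltnP j n; last by exists 0.
  suff h : in_span n a (a j : R^o) by exists (Span h).
  apply/asboolP; exists (delta j); rewrite (bigD1 (Ordinal ltjn)) //= /delta.
  rewrite eqxx mulr1 big1 ?addr0 // => i; rewrite -val_eqE eq_sym /=.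
  by move/negbTE => ->; rewrite mulr0.
pose e j := projT1 (cid (e_sub j)).
have val_e j : (j < n)%N -> val (e j) = a j by exact: (projT2 (cid (e_sub j))).
pose c (r : span n a) := projT1 (cid (span_coef r)).
have cE r : val r = \sum_(j < n) a j * c r j.
  exact: (projT2 (cid (span_coef r))).
pose X := \sum_(j < n) << (m j, e j) >> : {freeg (M * span n a)%type / int}.
have relX : tensor_rel X.
  rewrite -[X]subr0; apply/eq_tensorP.
  apply: (flatM (f := val) val_inj); rewrite !tensor_map_pi raddf0 raddf_sum /=.
  rewrite raddf_sum raddf0 /= -[RHS](pure_tensor0l M (1 : R^o)) -am0.
  rewrite pure_tensor_suml; apply: eq_bigr => j _.
  rewrite pure_tensorZ -[in RHS](val_e j) // /freeg_map liftU scale1r /=.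
  congr (pure_tensor _ _); exact: esym (mulr1 _).
(* Sends $v \otimes r$ to the vector $(c_i(r) v)_i$. The choice [c] need not be linear, but its
   defects of linearity are syzygies of [a], so tensor relations land in [syz]. *)
pose th i x := zlift (fun p : M * span n a => c p.2 i *: p.1) x.
have thX x : tensor_rel x -> syz n a (th^~ x).
  elim=> {x} [v v' r|v r r'|k v r||x x' _ hx _ hx'].
  - apply: syz_nil => i _; rewrite /th !raddfB /= !zliftU /=.
    by rewrite scalerDr addrAC addrK subrr.
  - apply: syz_ext (syz_gen v (s := fun i => c (r + r') i - c r i - c r' i) _).
      by move=> i _; rewrite /th !raddfB /= !zliftU /= !scalerBl.
    under eq_bigr do rewrite !mulrBr.
    by rewrite !sumrB -!cE raddfD /= addrAC addrK subrr.
  - apply: syz_ext (syz_gen v (s := fun i => k * c r i - c (k *: r) i) _).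
      move=> i _; rewrite /th !raddfB /= !zliftU /= scalerBl scalerA.
      by rewrite mulrC.
    under eq_bigr do rewrite mulrBr mulrCA.
    by rewrite sumrB -mulr_sumr -!cE linearZ subrr.
  - by apply: syz_nil => i _; exact: raddf0.
  apply: syz_ext (syz_add hx (syz_opp hx')) => i _ /=; exact: raddfB.
(* The unit vector at [j] and [c (e j)] both represent [a j]. Their difference is a syzygy and
   accounts for the gap between the image of [X] and [m]. *)
have hX := syz_add (thX _ relX) (syz_sum (index_enum 'I_n)
  (fun j : 'I_n => syz_gen (m j) (s := fun i => delta j i - c (e j) i) _)).
apply: syz_ext (hX _) => [i ltin|j] /=; last first.
  under eq_bigr do rewrite mulrBr.
  rewrite sumrB -cE val_e // (bigD1 j) //= /delta eqxx mulr1 big1 ?addr0 ?subrr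
    //.
  by move=> i; rewrite eq_sym -val_eqE /= => /negbTE ->; rewrite mulr0.
rewrite /th raddf_sum /= -big_split /= (bigD1 (Ordinal ltin)) //= zliftU.
rewrite /delta eqxx scalerBl scale1r addrCA subrr addr0 big1 ?addr0 // => j.
rewrite -val_eqE /= => /negbTE ->; rewrite zliftU /= scalerBl scale0r.
by rewrite sub0r subrr.
Qed.

End Flat.

Lemma syz_cycle (R : comNzRingType) (M : lmodType R) n (b : nat -> R)
  (z : nat -> M) : syz n b z -> \sum_(i < n) b i *: z i = 0.
Proof.
elim=> [{}z h|s v {}z z' hs _ IH h].
  by rewrite big1 // => i _; rewrite h ?scaler0.
under eq_bigr do rewrite h // scalerDr scalerA.
by rewrite big_split /= IH addr0 -scaler_suml hs scale0r.
Qed.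

(** * Transfer of syzygies from A to B *)

Section FlatBaseChange.
Variables (A B : comNzRingType) (phi : {rmorphism A -> B}) (M : lmodType B).
Variables (n m : nat) (x : nat -> A) (b : nat -> B) (c : nat -> nat -> B).
Hypothesis flatM : flat (restrict_scalars phi M).
Hypothesis min_x : forall s : nat -> A, \sum_(j < n) x j * s j = 0 ->
  forall j, (j < n)%N -> exists t : nat -> A, s j = \sum_(k < n) x k * t k.
Hypothesis xcb : forall j, phi (x j) = \sum_(i < m) c j i * b i.

Let flat_syz_phi (z : nat -> M) : \sum_(j < n) phi (x j) *: z j = 0 ->
  @syz A (restrict_scalars phi M) n x z.
Proof. exact: (flat_syz flatM (m := z)). Qed.

(** By flatness a relation between the [phi (x j)] in [M] comes from syzygies over [A], whose
    entries lie in the ideal of the [x j] by [min_x]. *)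
Lemma min_syz_flat : min_syz n (phi \o x) M.
Proof.
move=> p /flat_syz_phi; elim=> [{}p h|s v {}p p' hs _ IH h] j ltjn.
  exists (fun=> 0); rewrite h // big1 // => i _; exact: scaler0.
have [q pq] := IH j ltjn; have [t st] := min_x hs ltjn.
exists (fun k => phi (t k) *: v + q k); rewrite h // pq.
under [RHS]eq_bigr do rewrite scalerDr scalerA -rmorphM.
by rewrite big_split /= -scaler_suml -rmorph_sum -st.
Qed.

Lemma flat_syz_codomain (z : nat -> M) : (m <= n)%N ->
  \sum_(i < m) b i *: z i = 0 -> syz m b z.
Proof.
move=> lemn bz0.
have [p [z' [hz' zE]]] := koszul_cycle1 min_syz_flat xcb lemn bz0.
(* Pairing $z = \sum_j x_j p_j + z'$ with [b] kills [z'] and leaves a relation between the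
   [phi (x j)] with coefficients $b \cdot p_j$. *)
pose v j := \sum_(i < m) b i *: p j i.
have {}bz0 : \sum_(j < n) phi (x j) *: v j = 0.
  rewrite -[RHS]bz0.
  under [RHS]eq_bigr => i _ do rewrite (zE i (ltn_ord i)) scalerDr scaler_sumr.
  rewrite big_split /= (syz_cycle hz') addr0 exchange_big /=.
  apply: eq_bigr => j _; rewrite scaler_sumr; apply: eq_bigr => i _.
  by rewrite !scalerA mulrC.
have syz_v : syz m b (fun i => \sum_(j < n) c j i *: v j).
  elim: (flat_syz_phi bz0) => [w h|s u w w' hs _ IH h].
    by apply: syz_nil => i _; rewrite big1 // => j _; rewrite h // scaler0.
  (* A syzygy $s$ of the [x j] gives the syzygy $\sum_j \phi(s_j) c_j$ of [b]: its pairing with [b]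
     is $\phi(\sum_j x_j s_j)$. *)
  apply: (syz_cons (s := fun i =>
    \sum_(j < n) c j i * phi (s j)) (m := u) _ IH).
    under eq_bigr do rewrite mulr_sumr.
    rewrite exchange_big /= -[RHS](rmorph0 phi) -hs rmorph_sum.
    apply: eq_bigr => j _; rewrite rmorphM xcb mulr_suml.
    by apply: eq_bigr => i _; rewrite mulrA [b i * _]mulrC.
  move=> i _; rewrite scaler_suml -big_split /=.
  by apply: eq_bigr => j _; rewrite h // scalerDr scalerA.
(* The syzygy $x_j e_k - b_k c_j$ of [b]. Multiplied by [p j k] and summed over [k], it replaces
   $x_j p_j$ by $c_j (b \cdot p_j)$. *)
pose s j k i : B := phi (x j) * (i == k)%:R - b k * c j i.
have hs j (k : 'I_m) : \sum_(i < m) b i * s j k i = 0.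
  under eq_bigr do rewrite mulrBr.
  rewrite sumrB (bigD1 k) //= eqxx mulr1 big1 ?addr0; last first.
    by move=> i; rewrite -val_eqE /= => /negbTE ->; rewrite !mulr0.
  rewrite xcb mulr_sumr -sumrB big1 // => i _.
  by rewrite [c j i * _]mulrC mulrCA subrr.
have := syz_add hz' (syz_add syz_v (syz_sum (index_enum 'I_n) (fun j : 'I_n =>
  syz_sum (index_enum 'I_m) (fun k : 'I_m => syz_gen (p j k) (hs j k))))).
apply: syz_ext => i ltim; rewrite zE //= addrC; congr (_ + _).
rewrite -big_split; apply: eq_bigr => j _ /=.
under eq_bigr do rewrite /s scalerBl.
rewrite sumrB (bigD1 (Ordinal ltim)) //= eqxx mulr1 big1 ?addr0; last first.
  by move=> k; rewrite -val_eqE eq_sym /= => /negbTE ->; rewrite mulr0 scale0r.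
rewrite addrCA scaler_sumr -sumrB big1 ?addr0 // => k _.
by rewrite scalerA mulrC subrr.
Qed.

End FlatBaseChange.

(** * Submodules and products with an ideal *)

Definition submodule (R : comNzRingType) (L : lmodType R) (U : set L) : Prop :=
  U 0 /\ forall a u v, U u -> U v -> U (a *: u + v).

Section Submodule.
Variables (R : comNzRingType) (L : lmodType R) (U : set L).
Hypothesis subU : submodule U.

Lemma submodule0 : U 0. Proof. by case: subU. Qed.

Lemma submoduleZ a u : U u -> U (a *: u).
Proof. by case: subU => U0 UP Uu; rewrite -[_ *: _]addr0; exact: UP. Qed.

Lemma submoduleD u v : U u -> U v -> U (u + v).
Proof. by case: subU => U0 UP Uu Uv; rewrite -[u]scale1r; exact: UP. Qed.

Lemma submoduleN u : U u -> U (- u).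
Proof. by rewrite -scaleN1r; exact: submoduleZ. Qed.

Lemma submodule_sum (I : Type) (r : seq I) (P : pred I) (F : I -> L) :
  (forall i, P i -> U (F i)) -> U (\sum_(i <- r | P i) F i).
Proof. by apply: big_ind; [exact: submodule0 | exact: submoduleD]. Qed.

End Submodule.

Lemma idealP (R : comNzRingType) (I : set R) :
  ideal I <-> @submodule R R^o I.
Proof.
split=> [[I0 IP]|[I0 IP]].
  by split=> [|a u v Iu Iv]; [move: I0|have := IP a u v]; rewrite ?inE //;
    apply.
split=> [|a u v]; rewrite !inE //; exact: IP.
Qed.

Lemma submodule_principal (R : comNzRingType) (a : R) :
  @submodule R R^o [set x | exists r, x = a * r].
Proof.
split=> [|k u v [r ->] [s ->]]; first by exists 0; rewrite mulr0.
by exists (k * r + s); rewrite mulrDr mulrCA.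
Qed.

Inductive prod_set (R : comNzRingType) (L : lmodType R) (I : set R)
  (D : set L) : set L :=
| prod_set0 : prod_set I D 0
| prod_set_cons a d w : I a -> D d -> prod_set I D w ->
    prod_set I D (a *: d + w).

(** Scalars are absorbed by the coefficients in [I], so [D] may be any set. *)
Lemma submodule_prod_set (R : comNzRingType) (L : lmodType R) (I : set R)
  (D : set L) : ideal I -> submodule (prod_set I D).
Proof.
move=> /idealP subI; split=> [|k u v hu hv]; first exact: prod_set0.
elim: hu => [|a d w Ia Dd _ IH]; first by rewrite scaler0 add0r.
rewrite scalerDr scalerA -addrA; apply: prod_set_cons => //.
exact: (submoduleZ subI).
Qed.

Lemma prod_set1 (R : comNzRingType) (L : lmodType R) (I : set R) (D : set L)
  a d : I a -> D d -> prod_set I D (a *: d).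
Proof.
by move=> Ia Dd; rewrite -[_ *: _]addr0; apply: prod_set_cons => //;
  exact: prod_set0.
Qed.

(** * Artinian local rings and Nakayama's lemma *)

Section ArtinLocal.
Variable R : comNzRingType.

(** Without a minimal member, choice would iterate strictly smaller ideals into a chain that never
    stabilizes. *)
Lemma artinian_min (P : set R -> Prop) : artinian R ->
  (exists I, ideal I /\ P I) ->
  exists I, [/\ ideal I, P I
    & forall J, ideal J -> P J -> J `<=` I -> J = I].
Proof.
move=> artR [I0 [idI0 PI0]]; apply: contrapT => nomin.
pose T := {I : set R | ideal I /\ P I}.
have step (I : T) : exists J : T, sval J `<=` sval I /\ sval J <> sval I.
  apply: contrapT => noJ; apply: nomin; case: I noJ => I [idI PI] noJ.
  exists I; split=> // J idJ PJ JI; apply: contrapT => neqJI; apply: noJ.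
  by exists (exist _ J (conj idJ PJ)).
have [f fP] := choice step.
pose I k := iter k f (exist _ I0 (conj idI0 PI0)).
have [|k|n hn] := artR (fun k => sval (I k)).
- by move=> k; case: (svalP (I k)).
- by case: (fP (I k)).
by have [_] := fP (I n); apply; exact: (hn n.+1 (leqnSn n)).
Qed.

Lemma maximal_ideal_ex (a : R) : (forall b, a * b <> 1) ->
  exists I, maximal_ideal I /\ I a.
Proof.
move=> nonunit.
pose P (J : set R) := J = set0 \/ [/\ ideal J, J a & ~ J 1].
have [|I [PI maxI]] := @Zorn_bigcup R P.
  move=> F FP totF.
  have [allset0|/existsNP[J /not_implyP[FJ J0]]] :=
      pselect (forall J, F J -> J = set0).
    left; rewrite -subset0 => x [J FJ]; by rewrite (allset0 _ FJ).
  right; have id_mem K x : F K -> K x -> [/\ ideal K, K a & ~ K 1].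
    by move=> FK Kx; case: (FP _ FK) => // K0; rewrite K0 in Kx.
  have /set0P[x Jx] : J != set0 by exact/eqP.
  have [idJ Ja _] := id_mem _ _ FJ Jx.
  split; last by case=> K FK K1; have [] := id_mem _ _ FK K1.
    apply/idealP; split; first by exists J => //; case/idealP: idJ.
    move=> k u v [K FK Ku] [K' FK' K'v].
    have [/idealP[_ KP] _ _] := id_mem _ _ FK Ku.
    have [/idealP[_ K'P] _ _] := id_mem _ _ FK' K'v.
    have [sub|sub] := totF _ _ FK FK'.
      by exists K' => //; apply: K'P => //; exact: sub.
    by exists K => //; apply: KP => //; exact: sub.
  by exists J.
have Pa : P [set x | exists r, x = a * r].
  right; split; first exact/idealP/submodule_principal.
    by exists 1; rewrite mulr1.
  by case=> b ab1; exact: (nonunit b).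
case: PI => [I0|[idI Ia I1]].
  case: (maxI _ _ Pa); rewrite I0; split=> // h.
  by apply: (h a); exists 1; rewrite mulr1.
exists I; split=> //; split=> //; first by apply/eqP => IT; apply: I1;
  rewrite IT.
move=> J idJ IJ; have [J1|J1] := pselect (J 1).
  right; apply/seteqP; split=> // x _; rewrite -[x]mulr1.
  by move/idealP: idJ => /submoduleZ; apply.
left; apply: contrapT => neqJI; apply: (maxI J).
  rewrite properEneq; split=> //; apply/eqP => eIJ; exact: neqJI.
by right; split=> //; exact: IJ.
Qed.

Hypothesis localR : local_ring R.
Local Notation m := (local_maximal_ideal R).

Lemma local_maximal_idealP : maximal_ideal m.
Proof.
case: localR => I [maxI _]; rewrite /local_maximal_ideal.
by apply: (@getPex _ (@maximal_ideal R)); exists I.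
Qed.

Lemma ideal_local : @submodule R R^o m.
Proof. by apply/idealP; case: local_maximal_idealP. Qed.

Lemma local_unit a : ~ m a -> exists b, a * b = 1.
Proof.
move=> nma; apply: contrapT => nonunit.
have [|I [maxI Ia]] := @maximal_ideal_ex a.
  by move=> b ab; apply: nonunit; exists b.
case: localR => J [maxJ uniJ]; apply: nma.
by rewrite -(uniJ _ local_maximal_idealP) (uniJ _ maxI).
Qed.

Lemma local_max1 : ~ m 1.
Proof.
move=> m1; have [_ /eqP mT _] := local_maximal_idealP; apply: mT.
apply/seteqP; split=> // x _; rewrite -[x]mulr1.
exact: (submoduleZ ideal_local).
Qed.

Lemma local_subr1_unit a : m a -> exists b, (1 - a) * b = 1.
Proof.
move=> ma; apply: local_unit => m1a; apply: local_max1.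
by rewrite -(subrK a 1); exact: (submoduleD ideal_local).
Qed.

(** The unit $1 - b$ kills [a]; this is Nakayama's lemma for a principal ideal. *)
Lemma local_mul_fix a b : m b -> a = a * b -> a = 0.
Proof.
move=> mb ab; have [c bc] := local_subr1_unit mb.
by rewrite -[a]mulr1 -bc mulrA mulrBr mulr1 -ab subrr mul0r.
Qed.

Hypothesis artR : artinian R.

(** A minimal ideal among the $a^k R$ satisfies $a^k \in a^{k+1} R$, whence $a^k = 0$ by
    [local_mul_fix]. *)
Lemma local_nilpotent a : m a -> exists k, a ^+ k = 0.
Proof.
move=> ma; pose P (I : set R) := exists k, I = [set x | exists r,
  x = a ^+ k * r].
have [|I [_ [k ->] minI]] := @artinian_min P artR.
  by eexists; split; last (by exists 0%N); exact/idealP/submodule_principal.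
exists k; have eI : [set x | exists r, x = a ^+ k.+1 * r] =
    [set x | exists r, x = a ^+ k * r].
  apply: minI; [exact/idealP/submodule_principal | by exists k.+1 |].
  by move=> x [r ->]; exists (a * r); rewrite exprSr mulrA.
have : [set x | exists r, x = a ^+ k * r] (a ^+ k).
  by exists 1; rewrite mulr1.
rewrite -eI => -[r]; rewrite exprSr -mulrA; apply: local_mul_fix.
by rewrite mulrC; exact: (submoduleZ ideal_local).
Qed.

(* D need not be finitely generated: a minimal ideal J with J D not inside U
   is principal, and its generator a satisfies a = a b for some b in m. *)
Lemma nakayama (L : lmodType R) (U D : set L) : submodule U ->
  (forall d, D d -> exists u w, [/\ U u, prod_set m D w & d = u + w]) ->
  D `<=` U.
Proof.
move=> subU hD; apply: contrapT => /existsNP[d0 /not_implyP[Dd0 nUd0]].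
pose P (I : set R) := exists a d, [/\ I a, D d & ~ U (a *: d)].
have [|J [/idealP idJ [a [d [Ja Dd nUad]]] minJ]] := @artinian_min P artR.
  exists setT; split; first by apply/idealP.
  by exists 1, d0; rewrite scale1r.
have [u [w [Uu hw ed]]] := hD _ Dd.
have {}nUaw : ~ U (a *: w).
  move=> Uaw; apply: nUad; rewrite ed scalerDr.
  by apply: (submoduleD subU) => //; exact: (submoduleZ subU).
have [b [d' [mb Dd' nUabd]]] : exists b d', [/\ m b,
  D d' & ~ U ((a * b) *: d')].
  elim: hw nUaw => [|b d' w' mb Dd' _ IH nU].
    by rewrite scaler0; case; exact: submodule0.
  have [Uabd|nUabd] := pselect (U ((a * b) *: d')); last by exists b, d'.
  apply: IH => Uaw'; apply: nU; rewrite scalerDr scalerA.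
  exact: (submoduleD subU).
have eJ : [set x | exists r, x = a * b * r] = J.
  apply: minJ; first exact/idealP/submodule_principal.
    by exists (a * b), d'; split=> //; exists 1; rewrite mulr1.
  move=> _ [r ->]; rewrite -mulrA mulrC; exact: (submoduleZ idJ).
move: Ja; rewrite -eJ => -[r]; rewrite -mulrA => /local_mul_fix a0.
apply: nUad; rewrite a0 ?scale0r; first exact: submodule0.
by rewrite mulrC; exact: (submoduleZ ideal_local).
Qed.

End ArtinLocal.

(** * Finitely supported linear combinations *)

Section FiniteSupport.
Variables (R : comNzRingType) (L : lmodType R).
Local Notation F := {freeg L / R}.

Definition combine : F -> L := fglift id.

HB.instance Definition _ :=
  GRing.isZmodMorphism.Build F L combine (lift_is_additive id).

Lemma combineU a k : combine << a *g k >> = a *: k.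
Proof. exact: liftU. Qed.

Lemma combineE x : combine x = \sum_(k <- dom x) coeff k x *: k.
Proof.
by rewrite -{1}(freeg_sumE x) raddf_sum; apply: eq_bigr => k _; exact: combineU.
Qed.

Lemma combine_sum x t : uniq t -> {subset dom x <= t} ->
  combine x = \sum_(k <- t) coeff k x *: k.
Proof.
move=> ut sub; rewrite combineE [RHS](bigID (mem (dom x))) /=.
rewrite [X in _ = _ + X]big1 ?addr0 => [|k /coeff_outdom ->];
  last exact: scale0r.
rewrite -[RHS]big_filter; apply: perm_big; apply: uniq_perm.
- exact: uniq_dom.
- exact: filter_uniq.
by move=> k; rewrite mem_filter andb_idr //; exact: sub.
Qed.

Fact combine_is_scalable : scalable combine.
Proof.
move=> a x; rewrite [in RHS]combineE scaler_sumr.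
have -> : a *: x = \sum_(k <- dom x) << a * coeff k x *g k >> by [].
by rewrite raddf_sum; apply: eq_bigr => k _; rewrite scalerA; exact: combineU.
Qed.

HB.instance Definition _ :=
  GRing.isScalable.Build R F L _ combine combine_is_scalable.

(** The free module on [E], realised inside the free module on all of [L] so that [E] can vary while
    the type stays fixed. *)
Definition supported (E : set L) (x : F) : Prop :=
  forall k, ~ E k -> coeff k x = 0.

Lemma submodule_supported E : @submodule R F (supported E).
Proof.
split=> [k _|a x y sx sy k nEk]; first exact: coeff0.
by rewrite coeffD coeffZ sx // sy // mulr0 addr0.
Qed.

Lemma supportedU (E : set L) a k : E k -> supported E << a *g k >>.
Proof.
by move=> Ek l nEl; rewrite coeffU; case: eqP => [e|_];
  rewrite ?mulr0 // -e in nEl *.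
Qed.

End FiniteSupport.

(** * Bases modulo a submodule *)

Section ResidualBasis.
Variables (R : comNzRingType) (localR : local_ring R).
Local Notation m := (local_maximal_ideal R).
Variables (L : lmodType R) (U D : set L).
Local Notation F := {freeg L / R}.

(** For [U] containing $mE$, this is linear independence over $R/m$ of the family of classes of [E]
    modulo [U]. *)
Definition residually_free (E : set L) : Prop :=
  forall x : F, supported E x -> U (combine x) -> forall k, m (coeff k x).

Hypotheses (subU : submodule U) (mD : forall a d, m a -> D d -> U (a *: d)).

(** Zorn's lemma gives a maximal residually free [E]. A relation with unit coefficient at a further
    [d] can be solved for [d], so maximality makes [E] span [D] modulo [U]. *)
Lemma residual_basis : exists E, [/\ E `<=` D, residually_free E
  & forall d, D d -> exists x : F, supported E x /\ U (d - combine x)].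
Proof.
pose P E := E `<=` D /\ residually_free E.
have [|E [[ED freeE] maxE]] := @Zorn_bigcup L P.
  move=> G GP totG; split; first by move=> k [E GE Ek]; exact: (GP _ GE).1.
  move=> x sx; have [->|x0] := eqVneq x 0.
    by move=> _ k; rewrite coeff0; exact: submodule0 (ideal_local localR).
  (* The finite support of [x] lies in a single member of the chain. For [x = 0] the chain may be
     empty, hence the separate case above. *)
  suff [E [GE sE]] : exists E, G E /\ forall k, k \in dom x -> E k.
    apply: (GP _ GE).2 => k nEk; apply/eqP/negPn/negP.
    by rewrite -mem_dom => /sE.
  have : forall k, k \in dom x -> exists2 E, G E & E k.
    move=> k; rewrite mem_dom => xk0; apply: contrapT => nGk.
    by move/eqP: xk0; apply; apply: sx => -[E GE Ek]; apply: nGk; exists E.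
  have : dom x != [::] by rewrite dom_eq0.
  elim: (dom x) => // k [|k' s] IHs _ sG.
    have [E GE Ek] := sG k (mem_head _ _).
    by exists E; split=> // l; rewrite inE => /eqP ->.
  have [//|l ls|E [GE sE]] := IHs.
    by apply: sG; rewrite inE ls orbT.
  have [E' GE' E'k] := sG k (mem_head _ _).
  have [sub|sub] := totG _ _ GE GE'.
    exists E'; split=> // l; rewrite inE => /predU1P[-> //|/sE].
    exact: sub.
  exists E; split=> // l; rewrite inE => /predU1P[->|/sE //].
  exact: sub.
exists E; split=> // d Dd; apply: contrapT => nEd.
have Ed : ~ E d.
  move=> Ed; apply: nEd; exists << d >>; split; first exact: supportedU.
  by rewrite combineU scale1r subrr; exact: submodule0.
apply: (maxE (E `|` [set d])).
  by split=> [k|/(_ d)]; [left | move=> h; apply/Ed/h; right].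
split=> [k [/ED //|-> //]|x sx Ux].
pose c := coeff d x; pose x' := x - << c *g d >>.
have sx' : supported E x'.
  move=> k nEk; rewrite coeffB coeffU; case: eqP => [<-|neq].
    by rewrite mulr1 subrr.
  by rewrite mulr0 subr0; apply: sx => -[//|e]; apply: neq.
have xE : combine x = c *: d + combine x'.
  by rewrite linearB /= combineU addrC subrK.
have [mc|/(local_unit localR)[b cb1]] := pselect (m c).
  have Ux' : U (combine x').
    rewrite -[combine x'](addKr (c *: d)) -xE.
    by apply: submoduleD => //; apply: submoduleN => //; exact: mD.
  move=> k; have := freeE _ sx' Ux' k; rewrite coeffB coeffU.
  case: eqP => [<- _|_]; last by rewrite mulr0 subr0.
  exact: mc.
case: nEd; exists (- b *: x'); split.
  exact: submoduleZ (submodule_supported E) _ _ sx'.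
rewrite linearZ /= scaleNr opprK -[d]scale1r -cb1 mulrC -scalerA -scalerDr -xE.
exact: submoduleZ.
Qed.

End ResidualBasis.

(** * Flatness of free modules *)

Lemma freeg_int_ind (K : choiceType) (P : {freeg K / int} -> Prop) :
  P 0 -> (forall x y, P x -> P y -> P (x - y)) -> (forall k, P << k >>) ->
  forall x, P x.
Proof.
move=> P0 PB PU x.
have PN y : P y -> P (- y) by move=> Py; rewrite -sub0r; exact: PB.
have PD y z : P y -> P z -> P (y + z).
  by move=> Py Pz; rewrite -[z]opprK; apply: PB => //; exact: PN.
rewrite -(freeg_sumE x); apply: big_ind => // k _.
have Pn n : P << n%:Z *g k >>.
  elim: n => [|n IHn]; first by rewrite freegU0.
  by rewrite -addn1 PoszD -freegUD; exact: PD.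
by case: (coeff k x) => n //; rewrite NegzE -freegUN; exact: PN.
Qed.

Section FreeFlat.
Variables (R : comNzRingType) (M : lmodType R) (E : set M).
Hypothesis freeE : forall x : {freeg M / R},
  supported E x -> combine x = 0 -> x = 0.
Hypothesis spanE : forall v : M, exists x : {freeg M / R},
  supported E x /\ combine x = v.

Let coords (v : M) : {freeg M / R} := projT1 (cid (spanE v)).

Let coords_supported v : supported E (coords v).
Proof. by rewrite /coords; case: cid => x []. Qed.

Let coordsK v : combine (coords v) = v.
Proof. by rewrite /coords; case: cid => x []. Qed.

Let coords_linear a v w : coords (a *: v + w) = a *: coords v + coords w.
Proof.
apply/eqP; rewrite -subr_eq0; apply/eqP/freeE.
  have sub := submodule_supported E.
  apply: (submoduleD sub) => //; apply: (submoduleN sub).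
  by apply: (submoduleD sub) => //; exact: (submoduleZ sub).
by rewrite linearB linearP /= !coordsK subrr.
Qed.

Let coef (N : lmodType R) (e : M) : {freeg (M * N)%type / int} -> N :=
  zlift (fun p => coeff e (coords p.1) *: p.2).

Let coef0 (N : lmodType R) e : @coef N e 0 = 0.
Proof. exact: raddf0. Qed.

Let coefB (N : lmodType R) e x y : @coef N e (x - y) = coef e x - coef e y.
Proof. exact: raddfB. Qed.

Let coefU (N : lmodType R) e p : @coef N e << p >> = coeff e (coords p.1) *:
  p.2.
Proof. exact: zliftU. Qed.

Let coef_rel (N : lmodType R) e (y : {freeg (M * N)%type / int}) :
  tensor_rel y -> coef e y = 0.
Proof.
elim=> [v v' w|v w w'|a v w||x x' _ hx _ hx']; last 2 first.
- exact: coef0.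
- by rewrite coefB hx hx' subrr.
- rewrite !coefB !coefU /= -{1}[v]scale1r coords_linear scale1r coeffD scalerDl.
  by rewrite addrAC addrK subrr.
- by rewrite !coefB !coefU /= scalerDr addrAC addrK subrr.
rewrite coefB !coefU /= -[a *: v]addr0 coords_linear.
have -> : coords 0 = 0 by apply: freeE => //; exact: coordsK.
by rewrite addr0 coeffZ scalerA mulrC subrr.
Qed.

(** A tensor is recovered from its coordinates. Allowing every finite [t] that contains [s] lets two
    tensors be expanded over a common index set. *)
Let coef_pi (N : lmodType R) (y : {freeg (M * N)%type / int}) :
  exists s : seq M, forall t, uniq t -> {subset s <= t} ->
    \pi_{ideal_quot @tensor_relb R M N} y =
    \sum_(e <- t) pure_tensor e (coef e y) :> tensor M N.
Proof.
elim/freeg_int_ind: y => [|x y [s hs] [s' hs']|[v w]].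
- exists [::] => t _ _; rewrite raddf0 big1 // => e _.
  by rewrite coef0 pure_tensor0r.
- exists (s ++ s') => t ut sub; rewrite pi_tensorB (hs t) ?(hs' t) //;
  last 2 first.
  + by move=> e es; apply: sub; rewrite mem_cat es orbT.
  + by move=> e es; apply: sub; rewrite mem_cat es.
  rewrite -sumrB; apply: eq_bigr => e _.
  rewrite -{1}[coef e x](subrK (coef e y)) pure_tensorDr addrK.
  by rewrite coefB.
exists (dom (coords v)) => t ut sub.
rewrite -/(pure_tensor v w) -{1}[v]coordsK (combine_sum ut sub).
rewrite pure_tensor_suml; apply: eq_bigr => e _.
by rewrite pure_tensorZ coefU.
Qed.

(** Tensors are determined by their coordinates [coef e], which are natural in the second factor, so
    injectivity is tested coordinatewise. *)
Lemma flat_of_basis : flat M.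
Proof.
move=> N N' f injf t1 t2.
have nat e (y : {freeg (M * N)%type / int}) :
    coef e (freeg_map f y) = f (coef e y).
  elim/freeg_int_ind: y => [|x y hx hy|[v w]].
  - by rewrite raddf0 !coef0 raddf0.
  - by rewrite raddfB !coefB raddfB hx hy.
  by rewrite /freeg_map liftU scale1r !coefU linearZ.
rewrite /tensor_map => /eq_tensorP; rewrite -raddfB => /coef_rel h.
rewrite -(reprK t1) -(reprK t2); apply/eqP.
rewrite -subr_eq0 -pi_tensorB; have [s hs] := coef_pi (repr t1 - repr t2).
rewrite (hs (undup s)) ?undup_uniq // => [|e]; last by rewrite mem_undup.
rewrite big1 // => e _; have := h e; rewrite nat -(raddf0 f) => /injf ->.
exact: pure_tensor0r.
Qed.

End FreeFlat.

(** * Flatness from syzygies over an Artinian local ring *)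

Section LocalArtin.
Variables (R : comNzRingType) (artR : artinian R) (localR : local_ring R).
Local Notation m := (local_maximal_ideal R).

Lemma ideal_max : ideal m.
Proof. by case: (local_maximal_idealP localR). Qed.

(** A vector $s v$ with [s] a syzygy lifts to $s$ times a preimage of [v], which is still killed by
    pairing with [b]. *)
Lemma syz_lift (M : lmodType R) (E : set M) n (b : nat -> R) (z : nat -> M) :
  (forall v, exists x : {freeg M / R}, supported E x /\ combine x = v) ->
  syz n b z -> exists f : nat -> {freeg M / R},
    [/\ forall i, supported E (f i),
        forall i, (i < n)%N -> combine (f i) = z i
      & \sum_(i < n) b i *: f i = 0].
Proof.
move=> spanE; elim=> [{}z h|s v {}z z' hs _ [f [fE fz bf]] h].
  exists (fun=> 0); split=> [i|i lin|].
  - exact: submodule0 (submodule_supported E).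
  - by rewrite linear0 h.
  by rewrite big1 // => i _; rewrite scaler0.
have [x [xE xv]] := spanE v.
exists (fun i => s i *: x + f i); split=> [i|i lin|].
- have sub := submodule_supported E.
  by apply: (submoduleD sub) => //; exact: (submoduleZ sub).
- by rewrite linearP /= xv fz // h.
under eq_bigr do rewrite scalerDr scalerA.
by rewrite big_split /= bf addr0 -scaler_suml hs scale0r.
Qed.

(* The hypothesis on syzygies says that Tor_1(R/m, M) = 0. *)
Lemma flat_of_syz (M : lmodType R) n (b : nat -> R) :
  (forall i, (i < n)%N -> m (b i)) ->
  (forall a, m a -> exists c : nat -> R, a = \sum_(i < n) b i * c i) ->
  (forall z : nat -> M, \sum_(i < n) b i *: z i = 0 -> syz n b z) ->
  flat M.
Proof.
move=> mb gen_b syzM.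
have subm : submodule (prod_set m (setT : set M)).
  exact: submodule_prod_set ideal_max.
(* [E] lifts a basis of $M/mM$. It is shown to span [M] and then to be free, both times by
   Nakayama's lemma. *)
have [|E [_ freeE genE]] := residual_basis localR (D := setT) subm.
  by move=> a d ma _; exact: prod_set1.
have spanE v : exists x : {freeg M / R}, supported E x /\ combine x = v.
  pose S := [set v | exists x : {freeg M / R}, supported E x /\ combine x = v].
  have subS : submodule S.
    have sub := submodule_supported E.
    split=> [|a u w [x [xE <-]] [y [yE <-]]].
      by exists 0; split; [exact: submodule0 sub | exact: linear0].
    exists (a *: x + y); split; last exact: linearP.
    by apply: (submoduleD sub) => //; exact: (submoduleZ sub).
  apply: (nakayama localR artR subS (D := setT)) => // d _.
  have [x [xE hx]] := genE d I.
  exists (combine x), (d - combine x); split=> //; last by rewrite addrC subrK.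
  by exists x.
apply: (flat_of_basis _ spanE) => x0 x0E x00.
(* The relations between elements of [E]; Nakayama's lemma reduces $K = 0$ to $K \subseteq mK$. *)
pose K := [set x : {freeg M / R} | supported E x /\ combine x = 0].
suff : K `<=` [set 0] by apply; split.
apply: (nakayama localR artR) => [|x [xE x_0]].
  by split=> // a u v -> ->; rewrite scaler0 addr0.
have mx k : m (coeff k x).
  by apply: freeE => //; rewrite x_0; exact: submodule0.
have [c cE] := choice (fun k => gen_b _ (mx k)).
(* Expanding the coefficients of [x] in the generators of [m] gives $x = \sum_i b_i y_i$. *)
pose y i : {freeg M / R} := \sum_(k <- dom x) << c k i *g k >>.
have yE i : supported E (y i).
  rewrite /y big_seq; apply: (submodule_sum (submodule_supported E)) => k.
  rewrite mem_dom => xk; apply: supportedU; apply: contrapT => nEk.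
  by move/eqP: xk; apply; exact: xE.
have xy : x = \sum_(i < n) b i *: y i.
  apply/eqP/freeg_eqP => l; rewrite raddf_sum /=.
  under eq_bigr do rewrite coeffZ /y raddf_sum /=.
  have [xl|nxl] := boolP (l \in dom x); last first.
    rewrite (coeff_outdom nxl) big1 // => i _; rewrite big_seq big1 ?mulr0 //.
    move=> k xk; rewrite coeffU; case: eqP => [e|_]; last exact: mulr0.
    by rewrite -e xk in nxl.
  rewrite {1}cE; apply: eq_bigr => i _; congr (_ * _).
  rewrite (bigD1_seq l) ?uniq_dom //= coeffU eqxx mulr1 big1 ?addr0 // => k.
  by move=> /negbTE nkl; rewrite coeffU nkl mulr0.
(* The images of the [y i] in [M] form a relation on [b], which lifts to [f] with $\sum_i b_i f_i =
   0$. Then $x = \sum_i b_i (y_i - f_i)$ with each $y_i - f_i$ in [K]. *)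
have [|f [fE fy bf]] := syz_lift spanE (syzM (fun i => combine (y i)) _).
  by rewrite -[RHS]x_0 [in RHS]xy linear_sum; apply: eq_bigr => i _;
    rewrite linearZ.
exists 0, x; split=> //; last by rewrite add0r.
have -> : x = \sum_(i < n) b i *: (y i - f i).
  by under eq_bigr do rewrite scalerBr; rewrite sumrB bf subr0.
apply: submodule_sum => [|i _]; first exact: submodule_prod_set ideal_max.
apply: prod_set1; first exact: mb.
have sub := submodule_supported E.
split; last by rewrite linearB /= fy // subrr.
by apply: (submoduleD sub) => //; exact: (submoduleN sub).
Qed.

End LocalArtin.

(** * Generators of the maximal ideal and embedding dimension *)

Lemma submodule_combinations (R : comNzRingType) n (g : 'I_n -> R) :
  @submodule R R^o [set x | exists c, x = \sum_i g i * c i].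
Proof.
split=> [|a u v [c ->] [d ->]].
  by exists (fun=> 0); rewrite big1 // => i _; rewrite mulr0.
exists (fun i => a * c i + d i); rewrite scaler_sumr -big_split /=.
by apply: eq_bigr => i _; rewrite mulrDr mulrCA.
Qed.

Lemma smallest_idealE (R : comNzRingType) n (g : 'I_n -> R) :
  smallest (@ideal R) (range g) = [set x | exists c, x = \sum_i g i * c i].
Proof.
apply/seteqP; split=> x.
  apply; split; first exact/idealP/submodule_combinations.
  move=> _ [i _ <-]; exists (fun j => (j == i)%:R).
  rewrite (bigD1 i) //= eqxx mulr1 big1 ?addr0 // => j /negbTE ->.
  by rewrite mulr0.
move=> [c ->] J [/idealP idJ gJ]; apply: (submodule_sum idJ) => i _.
by rewrite mulrC; apply: (submoduleZ idJ); apply: gJ; exists i.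
Qed.

Lemma generated_byP (R : comNzRingType) (I : set R) n :
  generated_by I n <->
  exists g : 'I_n -> R, forall x, I x <-> exists c, x = \sum_i g i * c i.
Proof.
split=> -[g hg]; exists g; rewrite smallest_idealE in hg *.
  by rewrite hg.
by apply/seteqP; split=> x /hg.
Qed.

Section EmbeddingDimension.
Variables (R : comNzRingType) (artR : artinian R) (localR : local_ring R).
Local Notation m := (local_maximal_ideal R).

(** Let [E] lift a basis of $m/m^2$. Among the ideals spanned by $m^2$ and [E] without a finite set
    [s], a minimal one has [s] containing [E], since removing one more element would shrink it. So
    [E] is finite, and it generates [m] by Nakayama's lemma. *)
Lemma local_max_fg : exists n, generated_by m n.
Proof.
have idm := ideal_max localR.
have subm2 : @submodule R R^o (@prod_set R R^o m m) by exact: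
  submodule_prod_set.
have [|E [Em freeE genE]] := residual_basis localR (D := m : set R^o) subm2.
  by move=> a d ma md; exact: prod_set1.
pose I (s : seq R) : set R := [set x | exists f : {freeg R^o / R},
  supported (E `\` [set` s]) f /\ @prod_set R R^o m m (x - combine f)].
have idI s : ideal (I s).
  have sub := submodule_supported (E `\` [set` s]).
  apply/idealP; split=> [|a u v [f [fE uf]] [g [gE vg]]].
    exists 0; split; first exact: submodule0 sub.
    by rewrite linear0 subr0; exact: submodule0 subm2.
  exists (a *: f + g); split.
    by apply: (submoduleD sub) => //; exact: (submoduleZ sub).
  rewrite linearP /= opprD addrACA -scalerBr.
  by apply: (submoduleD subm2) => //; exact: (submoduleZ subm2).
have [|_ [_ [s ->] minI]] := artinian_min artR (P := fun J =>
  exists s, J = I s).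
  by exists (I [::]); split=> //; exists [::].
have Es e : E e -> e \in s.
  move=> Ee; apply/negPn/negP => nes.
  have eI : I (e :: s) = I s.
    apply: minI => //; first by exists (e :: s).
    move=> x [f [fE xf]]; exists f; split=> // k nk; apply: fE => -[Ek /= kes].
    by apply: nk; split=> // /= ks; apply: kes; rewrite inE ks orbT.
  have : I s e.
    exists << e >>; split; first by apply: supportedU; split=> //; exact/negP.
    by rewrite combineU scale1r subrr; exact: submodule0 subm2.
  rewrite -eI => -[f [fE ef]]; apply: (local_max1 localR).
  have := freeE (<< e >> - f) _ _ e; rewrite coeffB coeffU eqxx mulr1.
  rewrite (fE e) ?subr0; last by case=> _ /=; rewrite inE eqxx.
  apply; last by rewrite linearB /= combineU scale1r.
  have sub := submodule_supported E.
  apply: (submoduleD sub); first exact: supportedU.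
  by apply: (submoduleN sub) => k nEk; apply: fE => -[].
pose t := [seq x <- s | `[< E x >]].
have tE x : (x \in t) = `[< E x >].
  by rewrite mem_filter andb_idr // => /asboolP /Es.
exists (size t); apply/generated_byP; exists (fun i => t`_i).
have subt := submodule_combinations (fun i : 'I_(size t) => t`_i).
move=> x; split=> [|[c ->]]; last first.
  apply: (submodule_sum (ideal_local localR)) => i _; rewrite mulrC.
  apply: (submoduleZ (ideal_local localR)); apply: Em.
  by apply/asboolP; rewrite -tE mem_nth.
suff : (m : set R^o) `<=`
    [set x : R^o | exists c, x = \sum_(i < size t) t`_i * c i] by apply.
apply: (nakayama localR artR subt) => d /genE [f [fE df]].
exists (combine f), (d - combine f); split=> //; last by rewrite addrC subrK.
rewrite combineE big_seq; apply: (submodule_sum subt) => k kf.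
apply: (submoduleZ subt).
have kt : k \in t.
  rewrite tE; apply/asboolP; apply: contrapT => /fE kf0.
  by rewrite mem_dom kf0 eqxx in kf.
have ltk : (index k t < size t)%N by rewrite index_mem.
exists (fun j => (j == Ordinal ltk)%:R).
rewrite (bigD1 (Ordinal ltk)) //= eqxx mulr1 nth_index // big1 ?addr0 //.
by move=> j /negbTE ->; rewrite mulr0.
Qed.

(** Finite generation of [m] makes the set that defines [min_generators] inhabited. *)
Lemma edimP : generated_by m (edim R) /\
  forall k, generated_by m k -> (edim R <= k)%N.
Proof.
apply: (@xgetPex _ 0%N [set n | generated_by m n /\
  forall k, generated_by m k -> (n <= k)%N]).
have [n gn] := local_max_fg.
have ex : exists n, `[< generated_by m n >] by exists n; exact/asboolP.
exists (ex_minn ex); case: ex_minnP => k /asboolP gk mink; split=> // l gl.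
exact/mink/asboolP.
Qed.

(** A unit coefficient [s j] would allow [x j] to be eliminated, leaving fewer than [edim R]
    generators. *)
Lemma edim_min_syz (x s : 'I_(edim R) -> R) :
  (forall a, m a <-> exists c, a = \sum_i x i * c i) ->
  \sum_i x i * s i = 0 -> forall j, m (s j).
Proof.
have [_ minR] := edimP; move: x s minR;
  case: (edim R) => [|n] x s minR gx xs0 j.
  by case: j.
apply: contrapT => /(local_unit localR)[b sb1].
suff /minR : generated_by m n by rewrite ltnn.
have xj : x j = \sum_i x (fintype.lift j i) * (- (s (fintype.lift j i) * b)).
  move: xs0; rewrite (bigD1_ord j) //= => /(canRL (addrK _));
    rewrite sub0r => e.
  rewrite -[x j]mulr1 -sb1 mulrA e mulNr mulr_suml -sumrN.
  by apply: eq_bigr => i _; rewrite mulrN mulrA.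
apply/generated_byP; exists (x \o fintype.lift j) => a;
  split=> [/gx [c ->]|[c ->]].
  exists (fun i => - (s (fintype.lift j i) * b) * c j + c (fintype.lift j i)).
  rewrite (bigD1_ord j) //= xj mulr_suml -big_split /=.
  by apply: eq_bigr => i _; rewrite mulrDr mulrA.
apply/gx; exists (fun i => if unlift j i is Some k then c k else 0).
rewrite [RHS](bigD1_ord j) //= unlift_none mulr0 add0r.
by apply: eq_bigr => i _; rewrite liftK.
Qed.

End EmbeddingDimension.

(** * Locality of the morphism and conclusion *)

Lemma local_morphism (A B : comNzRingType) (phi : {rmorphism A -> B}) a :
  artinian A -> local_ring A -> local_ring B ->
  local_maximal_ideal A a -> local_maximal_ideal B (phi a).
Proof.
(* Elements of the maximal ideal of [A] are nilpotent, and a nilpotent element of the nonzero ring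
   [B] is not a unit. *)
move=> artA localA localB /(local_nilpotent localA artA) [k ak0].
apply: contrapT => /(local_unit localB)[b ab1].
have := oner_neq0 B; rewrite -(expr1n B k) -ab1 exprMn -rmorphXn ak0.
by rewrite rmorph0 mul0r eqxx.
Qed.

Theorem corollary1p2 (A B : comNzRingType) (phi : {rmorphism A -> B})
  (artinA : artinian A) (localA : local_ring A)
  (artinB : artinian B) (localB : local_ring B)
  (edimAB : edim A = edim B)
  (M : lmodType B) :
  flat (restrict_scalars phi M) -> flat M.
Proof.
move=> flatM.
have [/generated_byP[x gx] _] := edimP artinA localA.
have [/generated_byP[b gb] _] := edimP artinB localB.
have mem_gen (R : comNzRingType) n (I : set R) (g : 'I_n -> R) :
    (forall a, I a <-> exists c, a = \sum_i g i * c i) -> forall j, I (g j).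
  move=> gI j; apply/gI; exists (fun i => (i == j)%:R).
  rewrite (bigD1 j) //= eqxx mulr1 big1 ?addr0 // => i /negbTE ->.
  by rewrite mulr0.
(* Extension by zero, since the Koszul part indexes families by all natural numbers. *)
pose ext (R : comNzRingType) n (g : 'I_n -> R) i :=
  if insub i is Some j then g j else 0.
have extE (R : comNzRingType) n (g : 'I_n -> R) i : ext R n g (val i) = g i.
  by rewrite /ext valK.
have ext_out (R : comNzRingType) n (g : 'I_n -> R) i : (n <= i)%N -> ext R n g
  i = 0.
  by move=> leni; rewrite /ext insubN // -leqNgt.
have gen_b a : local_maximal_ideal B a ->
    exists c : nat -> B, a = \sum_(i < edim B) ext _ _ b i * c i.
  case/gb => c ->; exists (ext _ _ c).
  by apply: eq_bigr => i _; rewrite !extE.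
have coefs j : exists c : nat -> B,
    phi (ext _ _ x j) = \sum_(i < edim B) c i * ext _ _ b i.
  have [|c hc] := gen_b (phi (ext _ _ x j)).
    (* For [j] beyond [edim A] the entry is 0, which also lies in the maximal ideal. *)
    apply: local_morphism => //; have [ltj|leAj] := ltnP j (edim A).
      by rewrite (extE _ _ _ (Ordinal ltj)); exact: mem_gen gx _.
    rewrite ext_out //; exact: submodule0 (ideal_local localA).
  by exists c; rewrite hc; apply: eq_bigr => i _; rewrite mulrC.
have [c cE] := choice coefs.
apply: (flat_of_syz artinB localB (n := edim B) (b := ext _ _ b)) =>
  // [i lti|z].
  by rewrite (extE _ _ _ (Ordinal lti)); exact: mem_gen gb _.
(* The equality of embedding dimensions supplies the bound $m \le n$ of the descent. *)
apply: (flat_syz_codomain (n := edim A) flatM _ cE); last by rewrite edimAB.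
move=> s xs0 j ltj.
have /gx[t st] : local_maximal_ideal A (s j).
  apply: (edim_min_syz artinA localA (s := s) gx _ (Ordinal ltj)).
  by rewrite -[RHS]xs0; apply: eq_bigr => i _; rewrite extE.
exists (ext _ _ t); rewrite st.
by apply: eq_bigr => i _; rewrite !extE.
Qed.
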